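(* Let $\mathfrak C$ be a left cancellative small category. The following are equivalent: (a) $\partial\Omega$ is the smallest non-empty closed invariant subspace of $\widehat{\mathcal J}$; (b) $\partial\Omega$ is the smallest non-empty closed invariant subspace of $\Omega$; (c) for all $\mathfrak v,\mathfrak w\in\mathfrak C^0$ we have $\mathfrak w\mathfrak C\mathfrak v\ne\emptyset$. In that case, $I_l\ltimes\partial\Omega$ is purely infinite (in the sense of Matui) if and only if for all $\mathfrak v\in\mathfrak C^0$ there exist $a,b\in\mathfrak v\mathfrak C$ with $a\mathfrak C\cap b\mathfrak C=\emptyset$.
   Context: $\mathfrak C$ denotes the set of morphisms, $\mathfrak C^0\subseteq\mathfrak C$ the identity morphisms (identified with objects), $\mathfrak d,\mathfrak t$ domain and target; $cd$ is defined iff $\mathfrak d(c)=\mathfrak t(d)$; left cancellative means $cx=cy\Rightarrow x=y$. $c\mathfrak C=\{cx:\mathfrak t(x)=\mathfrak d(c)\}$, and $\mathfrak w\mathfrak C\mathfrak v$ is the set of $x$ with $\mathfrak t(x)=\mathfrak w$, $\mathfrak d(x)=\mathfrak v$. Each $c\in\mathfrak C$ gives the partial bijection $\mathfrak d(c)\mathfrak C\to c\mathfrak C$, $x\mapsto cx$; $I_l$ is the smallest semigroup of partial bijections of $\mathfrak C$ containing these and closed under inverses; $\mathcal J=\{\mathrm{dom}(s):s\in I_l\}$ is its semilattice of idempotents (product = intersection). $\widehat{\mathcal J}$ is the space of non-zero multiplicative maps $\chi:\mathcal J\to\{0,1\}$ with $\chi(\emptyset)=0$ if $\emptyset\in\mathcal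 J$ (pointwise convergence). $\Omega\subseteq\widehat{\mathcal J}$ consists of those $\chi$ such that whenever $e=\bigcup_{i=1}^nf_i$ ($e,f_i\in\mathcal J$) and $\chi(e)=1$, then $\chi(f_i)=1$ for some $i$. $\partial\Omega\subseteq\Omega$ is the closure of the set of $\chi\in\widehat{\mathcal J}$ with $\chi^{-1}(1)$ maximal. $s\in I_l$ acts by $\chi\mapsto s.\chi=\chi(s^{-1}\cdot s)$ from $\{\chi(s^{-1}s)=1\}$ onto $\{\chi(ss^{-1})=1\}$; $\Omega$ and $\partial\Omega$ are invariant. Invariant subspaces are subsets closed under this partial action. $I_l\ltimes\partial\Omega$ is the transformation groupoid: classes $[s,\chi]$ with $\chi\in\partial\Omega$, $\chi(s^{-1}s)=1$, $[s,\chi]=[t,\chi]$ iff $se=te$ for some $e\in\mathcal J$ with $\chi(e)=1$; source $\chi$, range $s.\chi$; topology such that $\{[s,\chi]:\chi(s^{-1}s)=1\}$ is open and mapped homeomorphically by the source map onto $\{\chi\in\partial\Omega:\chi(s^{-1}s)=1\}$. An étale groupoid $\mathcal G$ with totally disconnected locally compact Hausdorff unit space is purely infinite (Matui) if for every compact open $B\subseteq\mathcal G^{(0)}$ there are compact open bisections $U,V\subseteq\mathcal G$ with $\mathrm s(U)=\mathrm s(V)=B$, $\mathrm r(U)\cup\mathrm r(V)\subseteq B$ and $\mathrm r(U)\cap\mathrm r(V)=\emptyset$. *)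

(* Defs.v *)
From HB Require Import structures.
From mathcomp Require Import all_boot generic_quotient.
From mathcomp Require Import all_classical topology.

Set Implicit Arguments.
Unset Strict Implicit.
Unset Printing Implicit Defensive.

Local Open Scope classical_set_scope.
Local Open Scope relation_scope.

(* [comp c d] is the product cd (first d, then c). It is a total function whose
   values are unconstrained, and never used, unless dom c = tgt d. *)
Record smallCategory := SmallCategory {
  obj : Type;
  mor : Type;
  idm : obj -> mor;
  dom : mor -> obj;
  tgt : mor -> obj;
  comp : mor -> mor -> mor;
  dom_id : forall v, dom (idm v) = v;
  tgt_id : forall v, tgt (idm v) = v;
  dom_comp : forall c d, dom c = tgt d -> dom (comp c d) = dom d;
  tgt_comp : forall c d, dom c = tgt d -> tgt (comp c d) = tgt c;
  compA : forall b c d, dom b = tgt c -> dom c = tgt d ->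
    comp b (comp c d) = comp (comp b c) d;
  comp_idl : forall c, comp (idm (tgt c)) c = c;
  comp_idr : forall c, comp c (idm (dom c)) = c
}.

Definition left_cancellative (C : smallCategory) :=
  forall c x y : mor C, dom c = tgt x -> dom c = tgt y ->
    comp c x = comp c y -> x = y.

Record lcCategory := LCCategory {
  lc_category :> smallCategory;
  lc_cancel : left_cancellative lc_category
}.

Section Ideals.
Variable C : smallCategory.

(* cC *)
Definition rideal (c : mor C) : set (mor C) :=
  [set comp c x | x in [set x | tgt x = dom c]].

(* vC for an object v, i.e. [rideal (idm v)] *)
Definition into (v : obj C) : set (mor C) := [set x | tgt x = v].

(* wCv *)
Definition homset (w v : obj C) : set (mor C) :=
  [set x | tgt x = w /\ dom x = v].

Lemma rideal_id v : rideal (idm v) = into v.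
Proof.
apply/seteqP; split => [_ [x /= xv <-]|x /= <-].
  by rewrite /into /= tgt_comp ?dom_id ?tgt_id // xv dom_id.
by exists x; rewrite /= ?dom_id ?comp_idl.
Qed.

End Ideals.

(* Partial bijections of mor C are represented by their graphs; then s \; t is
   the composite st ("first t, then s") and s^-1 is the inverse. *)

Definition pdom (T : Type) (s : set (T * T)) : set T :=
  [set x | exists y, s (x, y)].

Definition pid (T : Type) (e : set T) : set (T * T) :=
  [set xy | e xy.1 /\ xy.2 = xy.1].

Definition partial_bijection (T : Type) (s : set (T * T)) :=
  (forall x y z, s (x, y) -> s (x, z) -> y = z) /\
  (forall x y z, s (x, z) -> s (y, z) -> x = y).

Section InverseHull.
Variable C : lcCategory.

(* the map dom(c)C -> cC, x |-> cx *)
Definition lmul (c : mor C) : set (mor C * mor C) :=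
  [set xy | tgt xy.1 = dom c /\ xy.2 = comp c xy.1].

Inductive in_Il : set (mor C * mor C) -> Prop :=
| in_Il_lmul c : in_Il (lmul c)
| in_Il_mul s t : in_Il s -> in_Il t -> in_Il (s \; t)
| in_Il_inv s : in_Il s -> in_Il (s^-1).

Definition Il : set (set (mor C * mor C)) := in_Il.

Lemma in_Il_bij s : in_Il s -> partial_bijection s.
Proof.
elim=> {s} [c|s t _ [sf si] _ [tf ti]|s _ [sf si]].
- split => [x y z [_ /= ->] [_ /= ->] //|x y z [/= xc ->] [/= yc]].
  exact: lc_cancel.
- split=> [x y z [u /= txu suy] [v /= txv svz]|x y z [u /= + +] [v /= + +]].
    by rewrite -(tf _ _ _ txu txv) in svz; exact: sf suy svz.
  by move=> txu suz tyv svz; rewrite -(si _ _ _ suz svz) in tyv; exact: ti txu tyv.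
- by split=> x y z /=; [exact: si|exact: sf].
Qed.

Definition Il_elt s (h : in_Il s) : Il := SigSub (mem_set h : s \in Il).

Lemma IlP (s : Il) : in_Il (\val s).
Proof. exact: set_valP. Qed.

Definition Il_mul (s t : Il) : Il := Il_elt (in_Il_mul (IlP s) (IlP t)).
Definition Il_inv (s : Il) : Il := Il_elt (in_Il_inv (IlP s)).

(* e in J is identified with the idempotent [pid e] of I_l, so that s^{-1}s is
   identified with dom(s). *)
Definition J : set (set (mor C)) := [set pdom s | s in Il].

Definition J_elt e (h : J e) : J := SigSub (mem_set h : e \in J).

Lemma JP (e : J) : J (\val e).
Proof. exact: set_valP. Qed.

Lemma J_inj (e f : J) : \val e = \val f -> e = f.
Proof. exact: val_inj. Qed.

Lemma pid_in_Il (e : J) : in_Il (pid (\val e)).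
Proof.
have [s Is <-] := JP e; suff -> : pid (pdom s) = s^-1 \; s.
  by apply: in_Il_mul => //; exact: in_Il_inv.
have [sf si] := in_Il_bij Is.
apply/seteqP; split=> [[x x']/= [[y sxy]/= ->]|[x x'] /= [y sxy sx'y]].
  by exists y.
by split; [exists y|exact: si sx'y sxy].
Qed.

Lemma J_preimage (s : Il) (e : J) : J (pdom (pid (\val e) \; \val s)).
Proof.
by eexists => //; apply: in_Il_mul; [exact: pid_in_Il|exact: IlP].
Qed.

Definition J_dom (s : Il) : J :=
  J_elt (ex_intro2 _ _ (\val s) (IlP s) erefl).

(* s^{-1} e s, whose domain is that of es *)
Definition J_conj (s : Il) (e : J) : J := J_elt (J_preimage s e).

Lemma J_conjE s e x : \val (J_conj s e) x <->
  exists2 y, \val s (x, y) & \val e y.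
Proof.
split=> [[z /= [y sxy [/= ey _]]]|[y sxy ey]]; first by exists y.
by exists y; exists y.
Qed.

Lemma J_conj_pid s e :
  pid (\val (J_conj s e)) = (\val s)^-1 \; (pid (\val e) \; \val s).
Proof.
have [sf si] := in_Il_bij (IlP s).
apply/seteqP; split=> [[x x'] [/J_conjE[y sxy ey] /= ->]|[x x']].
  by exists y => //; exists y.
move=> [_ [y /= sxy [/= ey ->]] /= sx'y]; split=> /=; last exact: si sx'y sxy.
by apply/J_conjE; exists y.
Qed.

Lemma J_setI (e f : J) : J (\val e `&` \val f).
Proof.
exists (pid (\val e) \; pid (\val f)).
  by apply: in_Il_mul; exact: pid_in_Il.
apply/seteqP; split=> [x [_ [_ /= [fx /= ->] [ex _]]] //|x [ex fx]].
by exists x; exists x.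
Qed.

Definition J_meet (e f : J) : J := J_elt (J_setI e f).

End InverseHull.

Arguments in_Il : clear implicits.
Arguments Il : clear implicits.
Arguments J : clear implicits.

Section Characters.
Variable C : lcCategory.
Local Notation J := (J C).
Local Notation Il := (Il C).

Definition is_character : set {ptws J -> bool} :=
  [set chi : {ptws J -> bool} | [/\ exists e, chi e,
                 forall e f, chi (J_meet e f) = chi e && chi f &
                 forall e, \val e = set0 -> chi e = false]].

(* A set seen as a type carries the subspace topology. *)
Definition Jhat : topologicalType := is_character.

Definition ev (chi : Jhat) : J -> bool := \val chi.

Lemma Jhat_char (chi : Jhat) : is_character (ev chi).
Proof. exact: set_valP. Qed.

Lemma ev_inj (chi psi : Jhat) : ev chi =1 ev psi -> chi = psi.
Proof. by move=> h; apply: val_inj; apply/funext. Qed.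

Lemma ev_mono (chi : Jhat) (e f : J) :
  \val e `<=` \val f -> ev chi e -> ev chi f.
Proof.
move=> ef; have [_ cM _] := Jhat_char chi.
suff {1}-> : e = J_meet e f by rewrite [ev _ _]cM => /andP[].
by apply: J_inj => /=; rewrite setIidl.
Qed.

Definition Omega : set Jhat :=
  [set chi | forall (e : J) (n : nat) (f : 'I_n -> J),
     \val e = \bigcup_i \val (f i) -> ev chi e -> exists i, ev chi (f i)].

Definition maximal_character (chi : Jhat) :=
  forall psi : Jhat, [set e | ev chi e] `<=` [set e | ev psi e] ->
    [set e | ev psi e] = [set e | ev chi e].

(* The closure is taken in Jhat, and maximality refers to all of Jhat. *)
Definition bdOmega : set Jhat := closure [set chi | maximal_character chi].

Lemma act_subproof (s : Il) (chi : Jhat) :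
  ev chi (J_dom s) -> is_character (fun e => ev chi (J_conj s e)).
Proof.
have [_ cM c0] := Jhat_char chi; have [sf si] := in_Il_bij (IlP s) => chis.
split=> [|e f|e e0].
- exists (J_dom (Il_inv s)); apply: ev_mono chis => x [y sxy].
  by apply/J_conjE; exists y => //; exists x.
- rewrite -[RHS]cM; congr (ev chi _); apply: J_inj; apply/seteqP; split.
    by move=> x /J_conjE[y sxy [ey fy]]; split; apply/J_conjE; exists y.
  move=> x [/J_conjE[y sxy ey] /J_conjE[z sxz fz]].
  by apply/J_conjE; exists y => //; split=> //; rewrite (sf _ _ _ sxy sxz).
- apply: c0; rewrite -subset0 => x /J_conjE[y _].
  by rewrite e0.
Qed.

(* s.chi = chi(s^{-1} . s), defined when chi(s^{-1}s) = 1 *)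
Definition act (s : Il) (chi : Jhat) (h : ev chi (J_dom s)) : Jhat :=
  SigSub (mem_set (act_subproof h)).

Lemma ev_act s chi h e : ev (@act s chi h) e = ev chi (J_conj s e).
Proof. by []. Qed.

Definition invariant (X : set Jhat) :=
  forall (s : Il) (chi : Jhat) (h : ev chi (J_dom s)), X chi -> X (act h).

(* Y is closed relative to S. *)
Definition closed_invariant_subspace (S Y : set Jhat) :=
  [/\ Y `<=` S, closed (Y : set (subspace S)) & invariant Y].

Definition smallest_nonempty_closed_invariant (S X : set Jhat) :=
  [/\ closed_invariant_subspace S X, X !=set0 &
      forall Y, closed_invariant_subspace S Y -> Y !=set0 -> X `<=` Y].

Lemma act_dom_inv s chi h : ev (@act s chi h) (J_dom (Il_inv s)).
Proof.
rewrite ev_act; apply: ev_mono h => x [y sxy].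
by apply/J_conjE; exists y => //; exists x.
Qed.

Lemma act_invK s chi h h' : @act (Il_inv s) (@act s chi h) h' = chi.
Proof.
have [sf si] := in_Il_bij (IlP s).
have [_ cM _] := Jhat_char chi.
apply: ev_inj => e; rewrite !ev_act.
transitivity (ev chi (J_meet (J_dom s) e)); last by rewrite [LHS]cM h.
congr (ev chi _); apply: J_inj; apply/seteqP; split=> x.
  move=> /J_conjE[y sxy /J_conjE[z /= szy ez]].
  by rewrite (si _ _ _ sxy szy); split => //; exists y.
by move=> [[y sxy] ex]; apply/J_conjE; exists y => //; apply/J_conjE; exists x.
Qed.

Lemma ev_continuous (e : J) : continuous (fun chi : Jhat => ev chi e).
Proof.
move=> chi.
apply: (@continuous_comp _ _ _ (fun chi : Jhat => \val chi : {ptws J -> bool})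
  (fun f => f e)); first exact: initial_continuous.
exact: (@proj_continuous J (fun=> bool) e).
Qed.

Lemma open_ev (e : J) b : open [set chi | ev chi e = b].
Proof.
have /continuousP/(_ [set b]) := @ev_continuous e; apply.
exact: discrete_open.
Qed.

Lemma Jhat_cvg (F : set_system Jhat) (chi : Jhat) : Filter F ->
  (forall e, F [set psi | ev psi e = ev chi e]) -> F --> chi.
Proof.
move=> FF Fe U [_ [[V oV <-] Vchi] VU]; apply: (filterS VU).
suff cv : \val @ F --> (\val chi : {ptws J -> bool}).
  by apply: cv; exact: open_nbhs_nbhs.
apply/cvg_sup => e W [_ [[B _ <-] Bchi] BW].
apply: (@filterS _ F _ _ _ _ (Fe e)) => psi pe; apply: BW.
by rewrite /preimage /= -[_ e]/(ev psi e) pe.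
Qed.

End Characters.

Section Invariance.
Variable C : lcCategory.
Local Notation Jhat := (Jhat C).

Lemma act_near (s : Il C) (chi : Jhat) (h : ev chi (J_dom s)) (U : set Jhat) :
  nbhs (act h) U ->
  \forall psi \near chi, exists k : ev psi (J_dom s), U (act k).
Proof.
pose tact psi := if pselect (ev psi (J_dom s)) is left k then act k else psi.
have near_ev e : \forall psi \near chi, ev psi e = ev chi e.
  apply: (open_nbhs_nbhs (p := chi) (A := [set psi | ev psi e = ev chi e])).
  by split => //; exact: open_ev.
have tact_cvg : tact @ nbhs chi --> act h.
  apply: Jhat_cvg => e.
  have := near_ev (J_conj s e); have := near_ev (J_dom s).
  apply: filterS2 => psi; rewrite h => k; rewrite ev_act /= /tact.
  by case: pselect => // k' <-.
move=> /tact_cvg; have := near_ev (J_dom s).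
apply: filterS2 => psi; rewrite h => k; rewrite /tact /=.
by case: pselect => // k' Uk; exists k'.
Qed.

Lemma maximal_invariant : invariant [set chi : Jhat | maximal_character chi].
Proof.
move=> s chi h chimax psi sub.
have k : ev psi (J_dom (Il_inv s)) by apply: sub; exact: act_dom_inv.
have k' : ev (act k) (J_dom (Il_inv (Il_inv s))) by exact: act_dom_inv.
have inv2 : Il_inv (Il_inv s) = s.
  apply: val_inj; rewrite /=; apply/seteqP; split; case => ? ?; exact: id.
have : [set e | ev (act k) e] = [set e | ev chi e].
  apply: chimax => e /= ce; rewrite ev_act; apply: sub; rewrite /= ev_act.
  rewrite -(act_invK (act_dom_inv h)) !ev_act in ce.
  exact: ce.
move=> eq_chi.
have {eq_chi} eq_chi : act k = chi.
  apply: ev_inj => e; apply/idP/idP => H; first by have : [set e | ev (act k) e] e by []; rewrite eq_chi.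
  by have : [set e | ev chi e] e by []; rewrite -eq_chi.
have := act_invK k'; move: k'; rewrite inv2 eq_chi => k'.
by rewrite (bool_irrelevance k' h) => ->.
Qed.

Lemma bdOmega_invariant : invariant (@bdOmega C).
Proof.
move=> s chi h chib U /act_near/chib [psi [/= psimax [k Uk]]].
by exists (act k); split => //; exact: maximal_invariant.
Qed.

End Invariance.

(* The unit space is a separate type, identified with a space of arrows through
   [gunit]. [gmul g h] is only meaningful when src g = rng h. *)
Record etaleGroupoid := EtaleGroupoid {
  unit_space : topologicalType;
  arrow : topologicalType;
  src : arrow -> unit_space;
  rng : arrow -> unit_space;
  gunit : unit_space -> arrow;
  gmul : arrow -> arrow -> arrow;
  ginv : arrow -> arrow;
  src_unit : forall x, src (gunit x) = x;
  rng_unit : forall x, rng (gunit x) = x;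
  src_mul : forall g h, src g = rng h -> src (gmul g h) = src h;
  rng_mul : forall g h, src g = rng h -> rng (gmul g h) = rng g;
  gmulA : forall g h k, src g = rng h -> src h = rng k ->
    gmul g (gmul h k) = gmul (gmul g h) k;
  gmul1g : forall g, gmul (gunit (rng g)) g = g;
  gmulg1 : forall g, gmul g (gunit (src g)) = g;
  src_inv : forall g, src (ginv g) = rng g;
  rng_inv : forall g, rng (ginv g) = src g;
  gmulVg : forall g, gmul (ginv g) g = gunit (src g);
  gmulgV : forall g, gmul g (ginv g) = gunit (rng g);
  src_continuous : continuous src;
  gunit_continuous : continuous gunit;
  ginv_continuous : continuous ginv;
  gmul_continuous : {within [set gh | src gh.1 = rng gh.2],
    continuous (fun gh : arrow * arrow => gmul gh.1 gh.2)};
  src_local_homeo : forall g, exists U : set arrow,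
    [/\ open U, U g, set_inj U src &
        forall V, open V -> V `<=` U -> open (src @` V)]
}.

(* An open such U is mapped homeomorphically onto open sets by src and rng. *)
Definition bisection (G : etaleGroupoid) (U : set (arrow G)) :=
  set_inj U (@src G) /\ set_inj U (@rng G).

Definition purely_infinite (G : etaleGroupoid) :=
  forall B : set (unit_space G), compact B -> open B ->
    exists U V : set (arrow G),
      [/\ [/\ compact U, open U & bisection U],
          [/\ compact V, open V & bisection V],
          @src G @` U = B /\ @src G @` V = B,
          @rng G @` U `|` @rng G @` V `<=` B &
          @rng G @` U `&` @rng G @` V = set0].

Section Germs.
Variables (C : lcCategory) (X : set (Jhat C)).
Hypothesis X_inv : invariant X.
Local Notation Il := (Il C).
Local Notation J := (J C).

Definition germ := {sx : Il * X | ev (\val sx.2) (J_dom sx.1)}.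

(* [s, chi] = [t, chi] iff se = te for some e with chi(e) = 1 *)
Definition agree (chi : Jhat C) (s t : Il) :=
  exists2 e : J, ev chi e & \val s \; pid (\val e) = \val t \; pid (\val e).

Definition germ_rel (g h : germ) : bool :=
  `[< (\val g).2 = (\val h).2 /\
      agree (\val (\val g).2) (\val g).1 (\val h).1 >].

Lemma ev_meet (chi : Jhat C) (e f : J) :
  ev chi (J_meet e f) = ev chi e && ev chi f.
Proof. by have [_ cM _] := Jhat_char chi; exact: cM. Qed.

Lemma agreeP chi s t : agree chi s t <->
  exists2 e : J, ev chi e &
    forall x y, \val e x -> \val s (x, y) <-> \val t (x, y).
Proof.
have mulpid (u : Il) (e : set (mor C)) x y :
    (\val u \; pid e) (x, y) <-> e x /\ \val u (x, y).
  by split=> [[_ [/= ex ->]] //|[ex uxy]]; exists x.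
split=> [[e ce st]|[e ce st]]; exists e => //.
  move=> x y ex; split => H.
    have : (\val s \; pid (\val e)) (x, y) by apply/mulpid.
    by rewrite st => /mulpid[].
  have : (\val t \; pid (\val e)) (x, y) by apply/mulpid.
  by rewrite -st => /mulpid[].
by apply/seteqP; split=> -[x y] /mulpid[ex uxy]; apply/mulpid; split=> //;
   apply/st.
Qed.

Lemma agree_refl chi s : agree chi s s.
Proof. by have [[e ce] _ _] := Jhat_char chi; exists e. Qed.

Lemma agree_sym chi s t : agree chi s t -> agree chi t s.
Proof. by case=> e ce st; exists e. Qed.

Lemma agree_trans chi s t u : agree chi s t -> agree chi t u -> agree chi s u.
Proof.
move=> /agreeP[e ce st] /agreeP[f cf tu]; apply/agreeP.
exists (J_meet e f); first by rewrite ev_meet ce.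
by move=> x y [ex fx]; rewrite st // tu.
Qed.

Lemma germ_rel_refl : reflexive germ_rel.
Proof. by move=> g; apply/asboolP; split=> //; exact: agree_refl. Qed.

Lemma germ_rel_sym : symmetric germ_rel.
Proof.
suff sym g h : germ_rel g h -> germ_rel h g.
  by move=> g h; apply/idP/idP; exact: sym.
by move=> /asboolP[E gh]; apply/asboolP; split=> //; rewrite -E; exact: agree_sym.
Qed.

Lemma germ_rel_trans : transitive germ_rel.
Proof.
move=> h g k /asboolP[E gh] /asboolP[E' hk]; apply/asboolP; split.
  exact: etrans E'.
by apply: agree_trans gh _; rewrite E.
Qed.

Canonical germ_equiv :=
  EquivRel germ_rel germ_rel_refl germ_rel_sym germ_rel_trans.

Definition germ_arrow : Type := {eq_quot germ_equiv}%qT.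
HB.instance Definition _ := Choice.on germ_arrow.

Definition mkgerm (s : Il) (x : X) (h : ev (\val x) (J_dom s)) : germ :=
  exist _ (s, x) h.

Definition gclass (s : Il) (x : X) (h : ev (\val x) (J_dom s)) : germ_arrow :=
  \pi_({eq_quot germ_equiv}%qT)%qT (mkgerm h).

(* The sets {[s, x] : x(s^{-1}s) = 1} are open and carry the topology for which
   the source map is a homeomorphism onto {x in X : x(s^{-1}s) = 1}; see
   [open_gclass] and [gclass_homeo]. *)
Definition germ_open (U : set germ_arrow) :=
  forall s : Il, open [set x : X | exists h, U (@gclass s x h)].

Lemma gclassP (g : germ_arrow) : exists s x h, g = @gclass s x h.
Proof.
elim/quotW: g => -[[s x] /= h]; exists s, x, h.
by congr (\pi_({eq_quot germ_equiv}%qT)%qT _); exact: val_inj.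
Qed.

Lemma gclass_eq s x h t y k :
  @gclass s x h = @gclass t y k <-> x = y /\ agree (\val x) s t.
Proof.
split=> [/eqmodP/asboolP //|st]; exact/eqmodP/asboolP.
Qed.

Lemma ev_near (x : X) (e : J) : ev (\val x) e ->
  \forall y \near x, ev (\val y) e.
Proof.
move=> xe; have oe := open_ev e true.
have := @initial_continuous X (Jhat C) (@set_val _ X) x _
  (open_nbhs_nbhs (conj oe xe)).
exact.
Qed.

Lemma germ_openT : germ_open setT.
Proof.
move=> s; rewrite openE => x [h _]; have := ev_near h.
by apply: filterS => y k; exists k.
Qed.

Lemma germ_openI : setI_closed germ_open.
Proof.
move=> U V oU oV s; have := openI (oU s) (oV s).
congr open; apply/seteqP; split=> x [].
  by move=> [h Uh] [h' Vh]; exists h; split=> //; rewrite (bool_irrelevance h h').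
by move=> h [Uh Vh]; split; exists h.
Qed.

Lemma germ_open_bigU (I : Type) (f : I -> set germ_arrow) :
  (forall i, germ_open (f i)) -> germ_open (\bigcup_i f i).
Proof.
move=> of_ s; have := bigcup_open (fun i (_ : setT i) => of_ i s).
congr open; apply/seteqP; split=> x.
  by move=> [i _ [h fh]]; exists h, i.
by move=> [h [i _ fh]]; exists i => //; exists h.
Qed.

HB.instance Definition _ :=
  isOpenTopological.Build germ_arrow germ_openT germ_openI germ_open_bigU.

Lemma germ_openE (U : set germ_arrow) : open U = germ_open U.
Proof. by []. Qed.

Lemma open_gclass s (W : set X) : open W ->
  open [set g | exists x h, W x /\ g = @gclass s x h].
Proof.
move=> oW; rewrite germ_openE => t; rewrite openE => x [h [y [k [Wy]]]].
move=> /gclass_eq[E]; rewrite -{}E {y} in k Wy *.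
move=> [e xe ts]; near=> y.
have h' : ev (\val y) (J_dom t) by near: y; exact: ev_near.
have k' : ev (\val y) (J_dom s) by near: y; exact: ev_near.
have ye : ev (\val y) e by near: y; exact: ev_near.
exists h', y, k'; split; last by apply/gclass_eq; split=> //; exists e.
by near: y; exact: open_nbhs_nbhs.
Unshelve. all: by end_near. Qed.

Lemma nbhs_gclass s x h (N : set germ_arrow) :
  nbhs (@gclass s x h) N <-> \forall y \near x, exists k, N (@gclass s y k).
Proof.
split.
  rewrite nbhsE => -[U [oU Ux] UN]; have := oU; rewrite germ_openE => /(_ s) os.
  have /open_nbhs_nbhs : open_nbhs x [set y | exists k, U (@gclass s y k)].
    by split=> //; exists h.
  by apply: filterS => y [k /UN]; exists k.
move=> xN; rewrite nbhsE; move: xN; rewrite /prop_near1 nbhsE => -[W [oW Wx] WN].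
exists [set g | exists y k, W y /\ g = @gclass s y k].
  by split; [exact: open_gclass|exists x, h].
move=> _ [y [k [/WN[k' Nk] ->]]].
by rewrite (bool_irrelevance k k').
Qed.

Definition germ_src (g : germ_arrow) : X := (\val (repr g)).2.

Lemma repr_gclass s x h : exists t k,
  repr (@gclass s x h) = @mkgerm t x k /\ agree (\val x) s t.
Proof.
case E : (repr (gclass h)) => [[t y] /= k].
have : gclass h = gclass k.
  have <- : \pi_({eq_quot germ_equiv}%qT)%qT (repr (gclass h)) = gclass h.
    exact: (@reprK _ {eq_quot germ_equiv}%qT).
  by rewrite E; congr (\pi_({eq_quot germ_equiv}%qT)%qT _); exact: val_inj.
move=> /gclass_eq[xy st]; subst y; by exists t, k.
Qed.

Lemma germ_srcE s x h : germ_src (@gclass s x h) = x.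
Proof. by rewrite /germ_src; have [t [k [-> _]]] := repr_gclass h. Qed.

Lemma gclass_homeo (s : Il) :
  let O := [set g | exists x h, g = @gclass s x h] in
  [/\ open O, set_inj O germ_src,
      germ_src @` O = [set x : X | ev (\val x) (J_dom s)] &
      forall U, U `<=` O -> open U <-> open (germ_src @` U)].
Proof.
move=> O; have OE : O = [set g | exists x h, setT x /\ g = @gclass s x h].
  by apply/seteqP; split=> g [x [h H]]; exists x, h => //; case: H.
split.
- by rewrite OE; apply: open_gclass; exact: openT.
- move=> g g'; rewrite !inE => -[x [h ->]] [y [k ->]]; rewrite !germ_srcE => E.
  by subst y; rewrite (bool_irrelevance h k).
- apply/seteqP; split=> [_ [g [x [h ->]] <-]|x /= h]; first by rewrite /= germ_srcE.
  by exists (gclass h); [exists x, h|exact: germ_srcE].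
move=> U UO.
have imE : germ_src @` U = [set x | exists h, U (@gclass s x h)].
  apply/seteqP; split=> [_ [g Ug <-]|x [h Uh]].
    by have [x [h E]] := UO _ Ug; subst g; rewrite germ_srcE; exists h.
  by exists (gclass h) => //; exact: germ_srcE.
split=> [oU|]; first by rewrite imE; have := oU; rewrite germ_openE; exact.
move=> /open_gclass => /(_ s); congr open; apply/seteqP; split=> g.
  by move=> [x [h []]]; rewrite imE => -[k Uk] ->; rewrite (bool_irrelevance h k).
move=> Ug; have [x [h E]] := UO _ Ug; exists x, h; split=> //.
by rewrite imE; exists h; rewrite -E.
Qed.

Definition actX s (x : X) (h : ev (\val x) (J_dom s)) : X :=
  SigSub (mem_set (X_inv h (set_valP x))).

Lemma agree_conj (chi : Jhat C) s t e : agree chi s t ->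
  ev chi (J_conj s e) = ev chi (J_conj t e).
Proof.
move=> /agreeP[f cf st].
transitivity (ev chi (J_meet f (J_conj s e))); first by rewrite ev_meet cf.
transitivity (ev chi (J_meet f (J_conj t e))); last by rewrite ev_meet cf.
congr (ev chi _); apply: J_inj; apply/seteqP; split=> x [fx] /J_conjE[y sxy ey];
  by split=> //; apply/J_conjE; exists y => //; apply/st.
Qed.

Lemma actX_agree s t x h k : agree (\val x) s t -> @actX s x h = @actX t x k.
Proof.
by move=> st; apply: val_inj; apply: ev_inj => e /=; rewrite !ev_act;
  exact: agree_conj.
Qed.

Lemma actX_near s x h (U : set X) : nbhs (@actX s x h) U ->
  \forall y \near x, exists k, U (@actX s y k).
Proof.
move=> [_ [[V oV <-] Vx] VU].
have nV : nbhs (@act C s (\val x) h) V by exact: open_nbhs_nbhs.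
have H := @initial_continuous X (Jhat C) (@set_val _ X) x _ (act_near nV).
apply: (@filterS _ (nbhs x) _ _ _ _ H) => y [k Vk]; exists k; apply: VU.
exact: Vk.
Qed.

Lemma agree_act s x (h : ev (\val x) (J_dom s)) t t' s' :
  agree (\val (actX h)) t t' -> agree (\val x) s s' ->
  agree (\val x) (Il_mul t s) (Il_mul t' s').
Proof.
move=> /agreeP[e xe tt'] /agreeP[f xf ss']; apply/agreeP.
exists (J_meet f (J_conj s e)); first by rewrite ev_meet xf.
move=> a c [fa /J_conjE[b sab eb]].
have [sf _] := in_Il_bij (IlP s).
split=> [[b' /= sab' tbc]|[b' /= sab' tbc]]; exists b' => /=.
- exact/ss'.
- by apply/tt' => //; rewrite -(sf _ _ _ sab sab').
- exact/ss'.
- move/ss': sab' => /(_ fa) sab'.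
  by apply/tt' => //; rewrite -(sf _ _ _ sab sab').
Qed.

Lemma ev_mul_dom (chi : Jhat C) s t :
  ev chi (J_dom (Il_mul t s)) = ev chi (J_conj s (J_dom t)).
Proof.
congr (ev chi _); apply: J_inj; apply/seteqP; split=> x.
  by move=> [z [y sxy tyz]]; apply/J_conjE; exists y => //; exists z.
by move=> /J_conjE[y sxy [z tyz]]; exists z, y.
Qed.

Definition germ_rng (g : germ_arrow) : X := actX (valP (repr g)).

Lemma germ_rngE s x h : germ_rng (@gclass s x h) = actX h.
Proof.
rewrite /germ_rng; have [t [k [-> st]]] := repr_gclass h.
exact/esym/actX_agree.
Qed.

Lemma idem_dom (e : J) : J_dom (Il_elt (pid_in_Il e)) = e.
Proof.
by apply: J_inj; apply/seteqP; split=> [x [y [/= ex _]] //|x ex]; exists x.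
Qed.

Definition germ_unit (x : X) : germ_arrow :=
  let: exist e xe := cid (let: And3 h _ _ := Jhat_char (\val x) in h) in
  @gclass (Il_elt (pid_in_Il e)) x (eq_rect_r (fun f => ev (\val x) f) xe (idem_dom e)).

Lemma germ_unitE (x : X) s h : (exists2 e : J, ev (\val x) e &
    forall a, \val e a -> \val s (a, a)) -> germ_unit x = @gclass s x h.
Proof.
move=> [f xf fs]; rewrite /germ_unit; case: cid => e xe.
apply/gclass_eq; split=> //; apply/agreeP; exists (J_meet e f).
  by rewrite ev_meet xe.
have [sf _] := in_Il_bij (IlP s).
move=> a b [/= ea fa]; split=> [[_ /= ->]|sab]; first exact: fs.
by split => //=; exact: (sf _ _ _ sab (fs _ fa)).
Qed.

Definition germ_inv (g : germ_arrow) : germ_arrow :=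
  @gclass (Il_inv (\val (repr g)).1) (germ_rng g)
    (act_dom_inv (valP (repr g))).

Lemma germ_invE s x h :
  germ_inv (@gclass s x h) = @gclass (Il_inv s) (actX h) (act_dom_inv h).
Proof.
apply/gclass_eq; rewrite germ_rngE; split=> //.
have [t [k [-> /= /agreeP[e xe st]]]] := repr_gclass h.
apply/agreeP; exists (J_conj (Il_inv s) e).
  by rewrite -(ev_act (act_dom_inv h)) act_invK.
have [_ si] := in_Il_bij (IlP s); have [_ ti] := in_Il_bij (IlP t).
move=> b a /J_conjE[c /= scb ec]; split=> /= H.
  have tcb : \val t (c, b) by apply/st.
  by rewrite (ti _ _ _ H tcb).
by apply/st; rewrite ?(si _ _ _ H scb).
Qed.

(* [t, s.x][s, x] = [ts, x]; the value is junk if the product is undefined *)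
Definition germ_mul (g h : germ_arrow) : germ_arrow :=
  let t := (\val (repr g)).1 in let s := (\val (repr h)).1 in
  if pselect (ev (\val (germ_src h)) (J_dom (Il_mul t s))) is left k
  then gclass k else g.

Lemma mul_dom s x (h : ev (\val x) (J_dom s)) t :
  ev (\val (actX h)) (J_dom t) -> ev (\val x) (J_dom (Il_mul t s)).
Proof. by rewrite ev_mul_dom. Qed.

Lemma germ_mulE s x h t k :
  germ_mul (@gclass t (@actX s x h) k) (gclass h) = gclass (mul_dom k).
Proof.
rewrite /germ_mul germ_srcE.
have [t' [k' [-> tt']]] := repr_gclass k.
have [s' [h' [-> ss']]] /= := repr_gclass h.
have H : ev (\val x) (J_dom (Il_mul t' s')).
  by rewrite ev_mul_dom -(agree_conj _ ss').
case: pselect => // H'; apply/gclass_eq; split=> //.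
by apply/agree_sym; exact: agree_act tt' ss'.
Qed.

Lemma gclass2P g h : germ_src g = germ_rng h ->
  exists s x (k : ev (\val x) (J_dom s)) t (l : ev (\val (actX k)) (J_dom t)),
    g = gclass l /\ h = gclass k.
Proof.
have [s [x [k ->]]] := gclassP h; have [t [y [l ->]]] := gclassP g.
rewrite germ_srcE germ_rngE => E; subst y.
by exists s, x, k, t, l.
Qed.

Lemma actX_mul s x (h : ev (\val x) (J_dom s)) t
    (k : ev (\val (actX h)) (J_dom t)) : actX (mul_dom k) = actX k.
Proof.
apply: val_inj; apply: ev_inj => e; rewrite /= !ev_act.
congr (ev (\val x) _); apply: J_inj; apply/seteqP; split=> a.
  move=> /J_conjE[c [b sab tbc] ec].
  by apply/J_conjE; exists b => //; apply/J_conjE; exists c.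
move=> /J_conjE[b sab /J_conjE[c tbc ec]].
by apply/J_conjE; exists c => //; exists b.
Qed.

Lemma germ_src_unit x : germ_src (germ_unit x) = x.
Proof. by rewrite /germ_unit; case: cid => e xe; rewrite germ_srcE. Qed.

Lemma germ_unitP x : exists e h,
  germ_unit x = @gclass (Il_elt (pid_in_Il e)) x h.
Proof. by rewrite /germ_unit; case: cid => e xe; eexists; eexists. Qed.

Lemma actX_idem e x h : @actX (Il_elt (pid_in_Il e)) x h = x.
Proof.
apply: val_inj; apply: ev_inj => f /=; rewrite ev_act.
have xe : ev (\val x) e by rewrite -(idem_dom e).
transitivity (ev (\val x) (J_meet e f)); last by rewrite ev_meet xe.
congr (ev (\val x) _); apply: J_inj; apply/seteqP; split=> a.
  by move=> /J_conjE[b [/= ea ->] fa].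
by move=> [ea fa]; apply/J_conjE; exists a.
Qed.

Lemma germ_rng_unit x : germ_rng (germ_unit x) = x.
Proof. by have [e [h ->]] := germ_unitP x; rewrite germ_rngE actX_idem. Qed.

Lemma germ_src_mul g h : germ_src g = germ_rng h ->
  germ_src (germ_mul g h) = germ_src h.
Proof.
by move=> /gclass2P[s [x [k [t [l [-> ->]]]]]]; rewrite germ_mulE !germ_srcE.
Qed.

Lemma germ_rng_mul g h : germ_src g = germ_rng h ->
  germ_rng (germ_mul g h) = germ_rng g.
Proof.
move=> /gclass2P[s [x [k [t [l [-> ->]]]]]].
by rewrite germ_mulE !germ_rngE actX_mul.
Qed.

Lemma germ_mulA g h k : germ_src g = germ_rng h -> germ_src h = germ_rng k ->
  germ_mul g (germ_mul h k) = germ_mul (germ_mul g h) k.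
Proof.
move=> gh /gclass2P[s [x [a [t [b [hE ->]]]]]].
move: gh; rewrite {}hE germ_rngE; have [u [y [c ->]]] := gclassP g.
rewrite germ_srcE => E; subst y; rewrite (germ_mulE b).
have c' : ev (\val (actX (mul_dom b))) (J_dom u) by rewrite actX_mul.
rewrite (germ_mulE c) (germ_mulE (mul_dom c)).
have -> : gclass c = gclass c'.
  by apply/gclass_eq; rewrite actX_mul; split=> //; exact: agree_refl.
rewrite germ_mulE.
apply/gclass_eq; split=> //; apply/agreeP.
have [[e xe] _ _] := Jhat_char (\val x); exists e => // p q _ /=.
split=> [[z [y sy ty] uz]|[y sy [z ty uz]]].
  by exists y => //; exists z.
by exists z => //; exists y.
Qed.

Lemma germ_mul1g g : germ_mul (germ_unit (germ_rng g)) g = g.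
Proof.
have [s [x [h ->]]] := gclassP g; rewrite germ_rngE.
have [e [k ->]] := germ_unitP (actX h); rewrite germ_mulE.
apply/gclass_eq; split=> //; apply/agreeP; exists (J_conj s e).
  by move: (k); rewrite idem_dom.
have [sf _] := in_Il_bij (IlP s).
move=> a b /J_conjE[c sac ec]; split=> /=.
  by move=> [d /= sad [/= _ ->]].
by move=> sab; exists b => //; split=> //=; rewrite (sf _ _ _ sab sac).
Qed.

Lemma germ_mulg1 g : germ_mul g (germ_unit (germ_src g)) = g.
Proof.
have [s [x [h ->]]] := gclassP g; rewrite germ_srcE.
have [e [k ->]] := germ_unitP x.
have h' : ev (\val (actX k)) (J_dom s) by rewrite actX_idem.
have -> : gclass h = gclass h'.
  by apply/gclass_eq; rewrite actX_idem; split=> //; exact: agree_refl.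
rewrite germ_mulE; apply/gclass_eq; rewrite actX_idem; split=> //.
apply/agreeP; exists e; first by rewrite -(idem_dom e).
move=> a b ea; split=> /=; first by move=> [d /= [_ /= ->]].
by move=> sab; exists a.
Qed.

Lemma germ_src_inv g : germ_src (germ_inv g) = germ_rng g.
Proof. exact: germ_srcE. Qed.

Lemma germ_rng_inv g : germ_rng (germ_inv g) = germ_src g.
Proof.
have [s [x [h ->]]] := gclassP g; rewrite germ_invE germ_rngE germ_srcE.
by apply: val_inj; rewrite /= act_invK.
Qed.

Lemma germ_mulVg g : germ_mul (germ_inv g) g = germ_unit (germ_src g).
Proof.
have [s [x [h ->]]] := gclassP g; rewrite germ_invE germ_srcE germ_mulE.
apply/esym/germ_unitE; exists (J_dom s) => //.
by move=> a [b sab]; exists b.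
Qed.

Lemma germ_mulgV g : germ_mul g (germ_inv g) = germ_unit (germ_rng g).
Proof.
have [s [x [h ->]]] := gclassP g; rewrite germ_invE germ_rngE.
have k := act_dom_inv h.
have E : actX (k : ev (\val (actX h)) _) = x.
  by apply: val_inj; rewrite /= act_invK.
have h' : ev (\val (actX (k : ev (\val (actX h)) _))) (J_dom s) by rewrite E.
have -> : gclass h = gclass h'.
  by apply/gclass_eq; rewrite E; split=> //; exact: agree_refl.
rewrite (bool_irrelevance (act_dom_inv h) k) germ_mulE.
apply/esym/germ_unitE; exists (J_dom (Il_inv s)) => //.
by move=> a [b sab]; exists b.
Qed.

Lemma germ_src_continuous : continuous germ_src.
Proof.
move=> g U; have [s [x [h ->]]] := gclassP g; rewrite germ_srcE => xU.
apply/nbhs_gclass; have := ev_near h; apply: filterS2 xU => y Uy k.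
by exists k; rewrite /= germ_srcE.
Qed.

Lemma germ_unit_continuous : continuous germ_unit.
Proof.
move=> x U; have [e [h E]] := germ_unitP x; rewrite E => /nbhs_gclass.
apply: filterS => y [k Uk] /=; rewrite (germ_unitE k) //.
by exists e => //; rewrite -(idem_dom e).
Qed.

Lemma germ_inv_continuous : continuous germ_inv.
Proof.
move=> g U; have [s [x [h ->]]] := gclassP g.
rewrite germ_invE => /nbhs_gclass/actX_near xU.
apply/nbhs_gclass; apply: filterS xU => y [k [l Ul]]; exists k.
by rewrite /= germ_invE (bool_irrelevance (act_dom_inv k) l).
Qed.

Lemma germ_mul_continuous : {within [set gh | germ_src gh.1 = germ_rng gh.2],
  continuous (fun gh : germ_arrow * germ_arrow => germ_mul gh.1 gh.2)}.
Proof.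
apply/subspace_continuousP => -[g h] /= gh U.
have [s [x [k [t [l [-> ->]]]]]] := gclass2P gh.
rewrite /from_subspace germ_mulE => /nbhs_gclass xU.
exists ([set g | exists y l', g = @gclass t y l'],
  [set g | exists y k', g = @gclass s y k' /\
     exists m, U (@gclass (Il_mul t s) y m)]).
  split=> /=; apply/nbhs_gclass.
    by have := ev_near l; apply: filterS => y m; exists m, y, m.
  have := ev_near k; apply: filterS2 xU => y [m Um] k'.
  by exists k', y, k'; split=> //; exists m.
move=> [_ _] [/= [z [l' ->]] [y [k' [-> [m Um]]]]].
rewrite germ_srcE germ_rngE => E; subst z; rewrite germ_mulE.
by rewrite (bool_irrelevance (mul_dom l') m).
Qed.

Lemma germ_src_local_homeo g : exists U : set germ_arrow,
  [/\ open U, U g, set_inj U germ_src &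
      forall V, open V -> V `<=` U -> open (germ_src @` V)].
Proof.
have [s [x [h ->]]] := gclassP g; have [oO iO _ hO] := gclass_homeo s.
eexists; split; [exact: oO|by exists x, h|exact: iO|].
by move=> V oV VO; apply/hO.
Qed.

(* I_l acting on an invariant subspace X of Jhat; X is the unit space *)
Definition transformation_groupoid : etaleGroupoid := EtaleGroupoid
  germ_src_unit germ_rng_unit germ_src_mul germ_rng_mul germ_mulA germ_mul1g
  germ_mulg1 germ_src_inv germ_rng_inv germ_mulVg germ_mulgV
  germ_src_continuous germ_unit_continuous germ_inv_continuous
  germ_mul_continuous germ_src_local_homeo.

End Germs.

(* Main.v *)
(** I_l acts on the principal character of a morphism x, which sends e to
    [x in e], by s.chi_x = chi_(s x), and preserves the domain of x. So the
    closure of the principal characters of the morphisms with domain v is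
    invariant and contained in Omega; if it contains the boundary, it meets
    {chi (wC) = 1}, whence a morphism from v to w. Conversely, the sets
    {chi e = 1} with psi e = 1 form a neighbourhood base of a maximal psi, and
    connectedness moves any character into each of them.

    For pure infiniteness, the boundary part of {chi (vC) = 1} is compact and
    open; two disjoint open subsets of it contain disjoint sets {chi e = 1} and
    {chi f = 1}, and any a in e, b in f have disjoint ideals. Conversely, a
    nonempty compact open B contains some {chi e = 1}. Any a in e has an
    infinite sequence of multiples q_n with disjoint ideals. As B meets
    {chi (vC) = 1} for finitely many v only, two families of left
    multiplications by elements q_n d, with d from v to the domain of q_n and
    all the indices n distinct, map B into disjoint subsets of B. *)

Require Import Defs.
From mathcomp Require Import all_boot.
From mathcomp Require Import all_classical topology.

Local Open Scope classical_set_scope.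
Set Implicit Arguments.
Unset Strict Implicit.
Unset Printing Implicit Defensive.


(* MathComp's [comp], [compA] and [invariant] would otherwise take precedence. *)
Import Defs.

(** * Elements of [I_l], and members of [J] as right ideals *)

Section InverseHullTheory.
Context {C : lcCategory}.
Implicit Types (s : set (mor C * mor C)) (x y z : mor C).

Lemma in_Il_dom s x y : in_Il C s -> s (x, y) -> dom y = dom x.
Proof.
move=> Is; elim: Is x y => {s} [c|s t _ IHs _ IHt|s _ IHs] x y /=.
- by move=> [/= xc ->]; rewrite dom_comp.
- by move=> [z /= /IHt <- /IHs].
- by move=> /IHs.
Qed.

(** Left multiplications commute with right multiplication by [z] by associativity; composites and
    inverses inherit this because elements of [I_l] preserve domains. Hence members of [J] are right
    ideals. *)
Lemma in_Il_comp s x y z : in_Il C s -> s (x, y) -> tgt z = dom x ->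
  s (comp x z, comp y z).
Proof.
move=> Is; elim: Is x y => {s} [c|s t Is IHs It IHt|s Is IHs] x y /=.
- by move=> [/= xc ->] /esym xz; split; rewrite /= ?tgt_comp ?compA. 
- move=> [u /= txu suy] zx; exists (comp u z); first exact: IHt.
  by apply: IHs => //; rewrite zx (in_Il_dom It txu).
- by move=> sxy zx; apply: IHs => //; rewrite zx (in_Il_dom Is sxy).
Qed.

(** This puts each member of [J] inside a single [vC], so that every character takes the value 1 at
    some [vC]. *)
Lemma in_Il_tgt s : in_Il C s -> exists v w : obj C,
  forall x y, s (x, y) -> tgt x = v /\ tgt y = w.
Proof.
elim=> {s} [c|s t _ [v [w vw]] _ [v' [w' vw']]|s _ [v [w vw]]].
- by exists (dom c), (tgt c) => x y [/= xc ->]; rewrite tgt_comp.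
- by exists v', w => x y [z /= /vw'[-> _] /vw[_ ->]].
- by exists w, v => x y /= /vw[-> ->].
Qed.

Lemma J_rideal (e : J C) x : \val e x -> @rideal C x `<=` \val e.
Proof.
have [s Is <-] := JP e => -[y sxy] _ [z /= zx <-].
by exists (comp y z); exact: in_Il_comp.
Qed.

Lemma J_into (e : J C) : exists v : obj C, \val e `<=` into v.
Proof.
have [s Is <-] := JP e; have [v [w vw]] := in_Il_tgt Is.
by exists v => x [y /vw[]].
Qed.

Lemma rideal_self x : rideal x x.
Proof. by exists (idm (dom x)); rewrite /= ?tgt_id ?comp_idr. Qed.

Definition Il_lmul (c : mor C) : Il C := Il_elt (in_Il_lmul c).

Lemma J_lmulE c : \val (J_dom (Il_lmul c)) = into (dom c).
Proof.
by apply/seteqP; split=> [x [y []] //|x xc]; exists (comp c x).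
Qed.

Lemma J_lmulVE c : \val (J_dom (Il_inv (Il_lmul c))) = rideal c.
Proof.
apply/seteqP; split=> [_ [x [/= xc ->]]|_ [x /= xc <-]]; exists x => //.
Qed.

Definition J_obj (v : obj C) : J C := J_dom (Il_lmul (idm v)).

Lemma J_objE v : \val (J_obj v) = into v.
Proof. by rewrite J_lmulE dom_id. Qed.

Lemma J_objP (x : mor C) v : \val (J_obj v) x <-> tgt x = v.
Proof. by rewrite J_objE. Qed.

End InverseHullTheory.

(** * Principal and maximal characters *)

Section CharacterTheory.
Context {C : lcCategory}.
Implicit Types (chi psi : Jhat C) (e f : J C) (x y : mor C) (v w : obj C).

Lemma ev_nonempty chi e : ev chi e -> exists x, \val e x.
Proof.
have [_ _ c0] := Jhat_char chi => chie; apply: contrapT => ne.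
suff : ev chi e = false by rewrite chie.
by apply: c0; rewrite -subset0 => x ex; apply: ne; exists x.
Qed.

Lemma ev_meet_nonempty chi e f : ev chi e -> ev chi f ->
  exists2 x, \val e x & \val f x.
Proof.
move=> chie chif; have /ev_nonempty[x []] : ev chi (J_meet e f).
  by rewrite ev_meet chie.
by exists x.
Qed.

Lemma ev_obj chi : exists v, ev chi (J_obj v).
Proof.
have [[e chie] _ _] := Jhat_char chi; have [v ev] := J_into e; exists v.
by apply: ev_mono chie; rewrite J_objE.
Qed.

Lemma ev_obj_inj chi v w : ev chi (J_obj v) -> ev chi (J_obj w) -> v = w.
Proof.
move=> chiv chiw.
by have [x /J_objP <- /J_objP] := ev_meet_nonempty chiv chiw.
Qed.

Lemma principal_subproof x : is_character (fun e => `[< \val e x >]).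
Proof.
split=> [|e f|e e0].
- by exists (J_obj (tgt x)); apply/asboolP/J_objP.
- by apply/asboolP/andP => [[ex fx]|[/asboolP ex /asboolP fx]];
    split=> //; exact/asboolP.
- by apply/asboolP; rewrite e0.
Qed.

Definition principal x : Jhat C := SigSub (mem_set (principal_subproof x)).

Lemma ev_principal x e : ev (principal x) e <-> \val e x.
Proof. by rewrite /ev /=; split=> [/asboolP|H] //; apply/asboolP. Qed.

Lemma principal_Omega x : Omega (principal x).
Proof.
by move=> e n f ef /ev_principal; rewrite ef => -[i _ fix_]; exists i;
  exact/ev_principal.
Qed.

Lemma act_principal (s : Il C) x y (h : ev (principal x) (J_dom s)) :
  \val s (x, y) -> act h = principal y.
Proof.
have [sf _] := in_Il_bij (IlP s) => sxy; apply: ev_inj => e.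
rewrite ev_act; apply/idP/idP => /ev_principal.
  by move=> /J_conjE[z sxz ez]; apply/ev_principal; rewrite (sf _ _ _ sxy sxz).
by move=> ey; apply/ev_principal/J_conjE; exists y.
Qed.

Lemma maximal_extension chi : exists2 psi, maximal_character psi &
  [set e | ev chi e] `<=` [set e | ev psi e].
Proof.
pose T := {psi : Jhat C | `[< [set e | ev chi e] `<=` [set e | ev psi e] >]}.
pose R (s t : T) := `[< [set e | ev (\val s) e] `<=` [set e | ev (\val t) e] >].
pose mkT psi (h : [set e | ev chi e] `<=` [set e | ev psi e]) : T :=
  exist _ psi (asboolT h).
have [||A totA|[psi /= chipsi] psimax] :=
  @ZL_preorder T (mkT chi (@subset_refl _ _)) R.
- by move=> s; apply/asboolP.
- move=> r s t /asboolP rs /asboolP st; apply/asboolP.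
  exact: subset_trans st.
(* Adding [chi] to the chain keeps its supremum non-zero and above [chi] even when [A] is empty. *)
- pose B := [set psi | psi = chi \/ exists2 s : T, A s & psi = \val s].
  have totB psi1 psi2 : B psi1 -> B psi2 ->
      (forall e, ev psi1 e -> ev psi2 e) \/ (forall e, ev psi2 e -> ev psi1 e).
    move=> [->|[s As ->]] [->|[t At ->]]; first by left.
    + by left; case: t {At} => /= t /asboolP.
    + by right; case: s {As} => /= s /asboolP.
    + by have [/asboolP|/asboolP] := totA _ _ As At; [left|right].
  have sup : is_character (fun e => `[< exists2 psi, B psi & ev psi e >]).
    split.
    + have [[e chie] _ _] := Jhat_char chi.
      by exists e; apply/asboolP; exists chi => //; left.
    + move=> e f; apply/asboolP/andP.
        by move=> [psi Bpsi]; rewrite ev_meet => /andP[? ?]; split;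
          apply/asboolP; exists psi.
      move=> [/asboolP[psi1 B1 e1] /asboolP[psi2 B2 f2]].
      by have [H|H] := totB _ _ B1 B2; [exists psi2|exists psi1] => //;
        rewrite ev_meet; apply/andP; split=> //; exact: H.
    + move=> e e0; apply/asboolP => -[psi _ /ev_nonempty[x]]; by rewrite e0.
  have chisup : [set e | ev chi e] `<=`
      [set e | ev (SigSub (mem_set sup) : Jhat C) e].
    by move=> e chie; apply/asboolP; exists chi => //; left.
  exists (mkT _ chisup) => s As; apply/asboolP => e se; apply/asboolP.
  by exists (\val s) => //; right; exists s.
have chipsi' := asboolW chipsi; exists psi => // phi psiphi.
apply/seteqP; split=> //.
have chiphi : [set e | ev chi e] `<=` [set e | ev phi e].
  by apply: subset_trans psiphi.
by have /asboolP := psimax (mkT phi chiphi) (asboolT psiphi).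
Qed.

(** It supplies a boundary point in [chi e = 1] for every non-empty [e] in [J]. *)
Lemma maximal_through x : exists2 psi, maximal_character psi &
  forall e, \val e x -> ev psi e.
Proof.
have [psi psimax psix] := maximal_extension (principal x).
by exists psi => // e ex; apply: psix; exact/ev_principal.
Qed.

(* If no member of the filter [psi] misses [f], then [psi] and [f] together
   generate a proper filter. *)
Lemma maximal_disjoint psi f : maximal_character psi -> ~~ ev psi f ->
  exists2 e, ev psi e & \val e `&` \val f = set0.
Proof.
move=> psimax; apply: contraNP => meets.
have {}meets e : ev psi e -> exists x, \val e x /\ \val f x.
  move=> psie; apply: contrapT => ne; apply: meets; exists e => //.
  by rewrite -subset0 => x [ex fx]; apply: ne; exists x.
have gen : is_character
    (fun g => `[< exists2 e, ev psi e & \val e `&` \val f `<=` \val g >]).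
  split.
  - have [[e psie] _ _] := Jhat_char psi; exists f; apply/asboolP.
    by exists e => // x [].
  - move=> g h; apply/asboolP/andP.
      by move=> [e psie gh]; split; apply/asboolP; exists e => // x /gh[].
    move=> [/asboolP[e1 p1 g1] /asboolP[e2 p2 h2]]; exists (J_meet e1 e2).
      by rewrite ev_meet p1.
    by move=> x [[x1 x2] fx]; split; [exact: g1|exact: h2].
  - move=> g g0; apply/asboolP => -[e /meets[x [ex fx]]].
    by rewrite g0 => /(_ x (conj ex fx)).
pose phi : Jhat C := SigSub (mem_set gen).
have /psimax E : [set e | ev psi e] `<=` [set e | ev phi e].
  by move=> e psie; apply/asboolP; exists e => // x [].
suff : [set e | ev psi e] f by [].
rewrite -E; have [[e psie] _ _] := Jhat_char psi; apply/asboolP.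
by exists e => // x [].
Qed.

(** If [psi] vanishes on every [f i], each [f i] is disjoint from a member of the filter [psi].
    Meeting [e] with these finitely many members leaves a non-empty part of [e] that the [f i] do
    not cover. *)
Lemma maximal_Omega psi : maximal_character psi -> Omega psi.
Proof.
move=> psimax e n f ef psie; apply: contrapT => nf.
have dis i : exists2 g, ev psi g & \val g `&` \val (f i) = set0.
  by apply: maximal_disjoint => //; apply/negP => fi; apply: nf; exists i.
have [g [psig ge gf]] : exists g, [/\ ev psi g, \val g `<=` \val e &
    forall i, \val g `&` \val (f i) = set0].
  (* Induction on [m], with the indices below [m] already avoided; from [m = n] on, [g] no longer
     changes. *)
  have : forall m, exists g, [/\ ev psi g, \val g `<=` \val e &
      forall i : 'I_n, (i < m)%N -> \val g `&` \val (f i) = set0].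
    elim=> [|m [g [psig ge gf]]]; first by exists e; split.
    have [mn|nm] := ltnP m n; last first.
      by exists g; split=> // i _; apply: gf; exact: leq_trans (ltn_ord i) nm.
    have [h psih hm] := dis (Ordinal mn); exists (J_meet g h); split.
    - by rewrite ev_meet psig.
    - by move=> x [/ge].
    - move=> i; rewrite ltnS leq_eqVlt => /orP[/eqP im|/gf gi].
        have -> : i = Ordinal mn by exact: val_inj.
        by rewrite /= -setIA hm setI0.
      by rewrite /= setIAC gi set0I.
  by move=> /(_ n)[g [? ? gf]]; exists g; split=> // i; exact: gf.
have [x gx] := ev_nonempty psig.
have := ge _ gx; rewrite ef => -[i _ fx].
by have : (\val g `&` \val (f i)) x by []; rewrite gf.
Qed.

(** * Closed invariant sets and neighbourhoods of maximal characters *)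

Lemma closure_invariant (X : set (Jhat C)) :
  invariant X -> invariant (closure X).
Proof.
move=> Xinv s chi h chiX U /act_near/chiX[psi [Xpsi [k Uk]]].
by exists (act k); split=> //; exact: Xinv.
Qed.

Lemma near_ev chi e : \forall psi \near chi, ev psi e = ev chi e.
Proof.
apply: (open_nbhs_nbhs (p := chi) (A := [set psi | ev psi e = ev chi e])).
by split=> //; exact: open_ev.
Qed.

(** A cover involves finitely many members of [J], and some neighbourhood of [chi] consists of
    characters agreeing with [chi] on all of them. *)
Lemma closed_Omega : closed (@Omega C).
Proof.
move=> chi chiO e n f ef chie.
have near_f : \forall psi \near chi, forall i, ev psi (f i) = ev chi (f i).
  exact: (@filter_forall _ _ (fun i psi => ev psi (f i) = ev chi (f i)) _ _
    (fun i => near_ev chi (f i))).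
have [psi [psiO [psie psif]]] := chiO _ (filterI (near_ev chi e) near_f).
have [|i fi] := psiO e n f ef; first by rewrite psie.
by exists i; rewrite -psif.
Qed.

Lemma bdOmega_Omega : @bdOmega C `<=` @Omega C.
Proof.
rewrite /bdOmega closureE; apply: smallest_sub; first exact: closed_Omega.
exact: maximal_Omega.
Qed.

Lemma closed_bdOmega : closed (@bdOmega C).
Proof. exact: closed_closure. Qed.

Lemma maximal_bdOmega psi : maximal_character psi -> bdOmega psi.
Proof. exact: subset_closure. Qed.

(* Any [f] with [psi f = 0] is disjoint from some [e] with [psi e = 1], so the
   conditions [chi f = 0] can be dropped from the basic neighbourhoods. *)
Lemma maximal_nbhs psi (U : set (Jhat C)) : maximal_character psi ->
  nbhs psi U -> exists2 e, ev psi e & [set chi | ev chi e] `<=` U.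
Proof.
move=> psimax.
pose F := filter_from [set e | ev psi e] (fun e => [set chi | ev chi e]).
have FF : Filter F.
  apply: filter_from_filter.
    by have [[e psie] _ _] := Jhat_char psi; exists e.
  move=> e f psie psif; exists (J_meet e f); first by rewrite /= ev_meet psie.
  by move=> chi /=; rewrite ev_meet => /andP.
have Fpsi : F --> psi.
  apply: Jhat_cvg => f; case psif : (ev psi f); first by exists f.
  have [e psie ef] := maximal_disjoint psimax (negbT psif); exists e => //.
  move=> chi /= chie; apply/negP => chif.
  have [x ex fx] := ev_meet_nonempty chie chif.
  by have : (\val e `&` \val f) x by []; rewrite ef.
by move=> /Fpsi [e psie eU]; exists e.
Qed.

End CharacterTheory.

(** * Minimality of the boundary and connectedness *)

Section Minimality.
Context {C : lcCategory}.
Local Notation Pa :=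
  (smallest_nonempty_closed_invariant [set: Jhat C] (@bdOmega C)).
Local Notation Pb :=
  (smallest_nonempty_closed_invariant (@Omega C) (@bdOmega C)).
Local Notation Pc := (forall v w : obj C, homset w v !=set0).

(** As [Omega] is closed, its relatively closed subsets are closed in [Jhat], so they already
    compete in the larger space. *)
Lemma smallest_Omega : Pa -> Pb.
Proof.
move=> [[_ _ inv] ne min]; split=> //.
  split=> //; first exact: bdOmega_Omega.
  apply: closed_subspaceW; exact: closed_bdOmega.
move=> Y [YO cY iY] Yne; apply: min => //; split=> //.
apply: closed_subspaceW; move: cY.
rewrite -closed_setIS; last exact: closed_Omega.
by rewrite setIidl.
Qed.

Lemma smallest_connected : Pb -> Pc.
Proof.
move=> [_ _ min] v w.
pose Y := [set @principal C y | y in [set y | dom y = v]].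
have Yinv : invariant Y.
  move=> s chi h [x /= xv xchi]; subst chi.
  have /ev_principal[y sxy] := h.
  exists y; last by rewrite (act_principal _ sxy).
  by rewrite /= (in_Il_dom (IlP s) sxy).
have [psi psimax psiw] := maximal_through (idm w).
have : closure Y psi.
  apply: min (maximal_bdOmega psimax).
    split; last exact: closure_invariant.
      rewrite closureE; apply: smallest_sub; first exact: closed_Omega.
      by move=> _ [y _ <-]; exact: principal_Omega.
    by apply: closed_subspaceW; exact: closed_closure.
  exists (principal (idm v)); apply: subset_closure; exists (idm v) => //.
  exact: dom_id.
(* A point of [Y] near [psi] takes the value 1 at [wC], so its morphism has target [w]. *)
move=> /(_ _ (near_ev psi (J_obj w)))[_ [[y /= yv <-]]].
rewrite /= psiw; last by apply/J_objP; rewrite tgt_id.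
by move=> /ev_principal/J_objP yw; exists y.
Qed.

(* A maximal [psi] has the neighbourhoods [chi e = 1] with [psi e = 1] as a
   base, and each of them meets every orbit: if [x] is in [e] and
   [chi (vC) = 1], pick [c] from [v] to [dom x] and act by [xc]. *)
Lemma connected_smallest : inhabited (obj C) -> Pc -> Pa.
Proof.
move=> [v0] conn; split.
- split=> //; last exact: bdOmega_invariant.
  apply: closed_subspaceW; exact: closed_bdOmega.
- have [psi psimax _] := maximal_through (idm v0).
  by exists psi; exact: maximal_bdOmega.
move=> Y [_ cY iY] [chi Ychi].
have {}cY : closed Y.
  by move: cY; rewrite -closed_setIS ?setIT //; exact: closedT.
rewrite /bdOmega closureE; apply: smallest_sub => // psi psimax; apply: cY => U.
move=> /(maximal_nbhs psimax)[e psie eU].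
have [x ex] := ev_nonempty psie; have [v chiv] := ev_obj chi.
have [c [cx cv]] := conn v (dom x).
have h : ev chi (J_dom (Il_lmul (comp x c))).
  by apply: ev_mono chiv; rewrite J_lmulE J_objE dom_comp ?cv.
exists (act h); split; first exact: iY.
apply: eU; rewrite /= ev_act; apply: ev_mono chiv => y /J_objP yv.
apply/J_conjE; exists (comp (comp x c) y).
  by split=> //=; rewrite dom_comp // cv.
rewrite -compA ?cv //; apply: J_rideal ex _ _; exists (comp c y) => //=.
by rewrite tgt_comp ?cv.
Qed.

End Minimality.

(** * Compact open subsets of the unit space *)

Section PurelyInfinite.
Context {C : lcCategory}.

(** An ultrafilter [F] converges to the character recording which sets [x f = 1] belong to [F]. This
    limit is non-zero because [F] contains [x e = 1], and it lies in [X] by closedness. *)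
Lemma compact_ev (X : set (Jhat C)) (e : J C) : closed X ->
  compact [set x : X | ev (\val x) e].
Proof.
move=> cX; rewrite compact_ultra => F FF Fe.
pose phi f := `[< F [set x : X | ev (\val x) f] >].
have phi_char : is_character phi.
  split; first by exists e; exact/asboolP.
    move=> f g; apply/asboolP/andP.
      move=> Ffg; split; apply/asboolP; apply: filterS Ffg => x /=;
        by rewrite ev_meet => /andP[].
    move=> [/asboolP Ff /asboolP Fg]; apply: filterS2 Ff Fg => x /= xf xg.
    by rewrite ev_meet xf.
  move=> f f0; apply/asboolP => /filter_ex[x /ev_nonempty[y]].
  by rewrite f0.
pose chi : Jhat C := SigSub (mem_set phi_char).
have cv : (fun x : X => \val x) @ F --> chi.
  apply: Jhat_cvg => f; rewrite /= /nbhs /=.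
  have -> : ev chi f = `[< F [set x : X | ev (\val x) f] >] by [].
  have [Ff|nFf] := pselect (F [set x : X | ev (\val x) f]).
    by rewrite asboolT.
  rewrite asboolF //.
  have [//|] := @in_ultra_setVsetC _ F [set x : X | ev (\val x) f] _.
  by apply: filterS => x /= /negP/negbTE.
have Xchi : X chi.
  apply: cX => B /cv FB; have [x Bx] := @filter_ex X F _ _ FB.
  exists (\val x); split=> //; exact: set_valP.
exists (SigSub (mem_set Xchi)); split; first exact/asboolP.
move=> U [_ [[V oV <-] Vx] VU]; apply: filterS VU _.
by apply: cv; exact: open_nbhs_nbhs.
Qed.

Lemma open_evX (X : set (Jhat C)) (e : J C) : open [set x : X | ev (\val x) e].
Proof. by rewrite openE => x; exact: ev_near. Qed.

Lemma compact_finite_objects (X : set (Jhat C)) (B : set X) : compact B ->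
  exists vs : seq {classic obj C},
    forall (x : X) (v : {classic obj C}),
      B x -> ev (\val x) (J_obj v) -> v \in vs.
Proof.
rewrite compact_near_coveringP => cB; set V := {classic obj C}.
(* Finite lists of objects, directed by inclusion: near covering compactness turns a local choice of
   list into one list valid on all of [B]. *)
pose F := filter_from setT (fun s : seq V => [set t : seq V | {subset s <= t}]).
have FF : Filter F.
  apply: filter_from_filter; first by exists [::].
  move=> s t _ _; exists (s ++ t) => // u su.
  by split=> v vs; apply: su; rewrite mem_cat vs ?orbT.
pose P (s : seq V) (x : X) := exists2 v : V, v \in s & ev (\val x) (J_obj v).
have [|vs _ /(_ vs (fun _ => id)) Bvs] := cB _ F P FF.
  move=> x _; have [v xv] := ev_obj (\val x).
  exists ([set y : X | ev (\val y) (J_obj v)], [set t : seq V | (v : V) \in t]).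
    split; first exact: ev_near.
    by exists [:: v : V] => // t; apply; rewrite mem_head.
  by move=> [y t] /= [yv vt]; exists (v : V).
exists vs => x v Bx xv; have [w wvs xw] := Bvs x Bx.
by rewrite (ev_obj_inj xv xw).
Qed.

(** * Source and range as open maps *)

Lemma src_open (G : etaleGroupoid) (U : set (arrow G)) :
  open U -> open (@src G @` U).
Proof.
move=> oU; rewrite openE => _ [g Ug <-].
have [W [oW Wg _ homeo]] := src_local_homeo g.
apply: filterS (_ : nbhs _ (@src G @` (U `&` W))).
  by move=> _ [h [Uh _] <-]; exists h.
apply: open_nbhs_nbhs; split; last by exists g.
by apply: homeo; [exact: openI|exact: subIsetr].
Qed.

Lemma ginvK (G : etaleGroupoid) (g : arrow G) : ginv (ginv g) = g.
Proof.
rewrite -[LHS]gmulg1 src_inv rng_inv -gmulVg gmulA ?src_inv ?rng_inv //.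
by rewrite gmulVg src_inv gmul1g.
Qed.

Lemma rng_open (G : etaleGroupoid) (U : set (arrow G)) :
  open U -> open (@rng G @` U).
Proof.
move=> oU; have -> : @rng G @` U = @src G @` (@ginv G @^-1` U).
  apply/seteqP; split=> _ [g Ug <-].
    by exists (ginv g); rewrite /= ?ginvK // src_inv.
  by exists (ginv g); rewrite //= rng_inv.
by apply: src_open; apply: open_comp oU => g _; exact: ginv_continuous.
Qed.

(** * From disjoint bisections to disjoint ideals *)

(** Maximal characters are dense in the boundary, and at such a point the sets [chi e = 1] form a
    neighbourhood base. *)
Lemma open_bdOmega (U : set (@bdOmega C)) : open U -> U !=set0 ->
  exists2 e : J C, \val e !=set0 & forall x : @bdOmega C, ev (\val x) e -> U x.
Proof.
move=> [V oV <-] [x Vx].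
have [psi [psimax Vpsi]] := set_valP x _ (open_nbhs_nbhs (conj oV Vx)).
have [e psie eV] := maximal_nbhs psimax (open_nbhs_nbhs (conj oV Vpsi)).
by exists e => [|y ye]; [exact: ev_nonempty psie|exact: eV].
Qed.

Lemma bdOmega_through (x : mor C) :
  exists psi : @bdOmega C, forall e : J C, \val e x -> ev (\val psi) e.
Proof.
have [psi /maximal_bdOmega psib psix] := maximal_through x.
by exists (SigSub (mem_set psib)).
Qed.

Local Notation G := (transformation_groupoid (@bdOmega_invariant C)).

Lemma purely_infinite_disjoint : purely_infinite G ->
  forall v : obj C, exists a b : mor C,
    [/\ into v a, into v b & rideal a `&` rideal b = set0].
Proof.
move=> pinf v; pose B := [set x : @bdOmega C | ev (\val x) (J_obj v)].
have [U [V [[_ oU _] [_ oV _] [sU sV] rB rUV]]] :=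
  pinf B (@compact_ev _ (J_obj v) closed_bdOmega) (@open_evX _ (J_obj v)).
have [psi psiv] := bdOmega_through (idm v).
have {psiv} Bpsi : B psi by apply: psiv; apply/J_objP; rewrite tgt_id.
have pick (W : set (arrow G)) : open W -> @src G @` W = B ->
    @rng G @` W `<=` B ->
    exists e a, [/\ into v a, \val e a &
      forall x : @bdOmega C, ev (\val x) e -> (@rng G @` W) x].
  move=> oW sW rW; have : (@src G @` W) psi by rewrite sW.
  move=> [g Wg _]; have [||e [a ea] eW] := @open_bdOmega (@rng G @` W).
  - exact: (@rng_open G).
  - by exists (rng g); exists g.
  exists e, a; split=> //; have [phi phia] := bdOmega_through a.
  have phiv := rW _ (eW _ (phia _ ea)); apply: ev_obj_inj phiv.
  exact/phia/J_objP.
have [|e [a [va ea eU]]] := pick U oU sU; first by move=> x ?; apply: rB; left.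
have [|f [b [vb fb fV]]] := pick V oV sV; first by move=> x ?; apply: rB; right.
(* A common multiple [z] would give a boundary character lying in both ranges. *)
exists a, b; split=> //; rewrite -subset0 => z [az bz].
have [phi phiz] := bdOmega_through z.
suff : (@rng G @` U `&` @rng G @` V) phi by rewrite rUV.
by split; [apply: eU|apply: fV]; apply: phiz;
  [exact: J_rideal az|exact: J_rideal bz].
Qed.

(** * From disjoint ideals to disjoint bisections *)

Lemma rideal_sub (x y : mor C) : rideal x y -> rideal y `<=` rideal x.
Proof.
by have := @J_rideal C (J_dom (Il_inv (Il_lmul x))) y; rewrite J_lmulVE.
Qed.

Lemma rideal_comp (x y : mor C) : tgt y = dom x -> rideal x (comp x y).
Proof. by exists y. Qed.

(* The elements are x a, x b a', x b b' a'', ..., where each pair a, b is a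
   disjoint one at the required object. *)
Lemma disjoint_sequence (x : mor C) :
  (forall v : obj C, exists a b : mor C,
    [/\ into v a, into v b & rideal a `&` rideal b = set0]) ->
  exists q : nat -> mor C, (forall n, rideal x (q n)) /\
    forall m n, m <> n -> rideal (q m) `&` rideal (q n) = set0.
Proof.
move=> dis.
have /choice[ab abP] : forall v : obj C, exists ab : mor C * mor C,
    [/\ tgt ab.1 = v, tgt ab.2 = v & rideal ab.1 `&` rideal ab.2 = set0].
  by move=> v; have [a [b [? ? ?]]] := dis v; exists (a, b).
pose p := fix p n := if n is m.+1 then comp (p m) (ab (dom (p m))).2 else x.
pose q n := comp (p n) (ab (dom (p n))).1.
have pS n : rideal (p n) (p n.+1).
  by apply: rideal_comp; have [] := abP (dom (p n)).
have pq n : rideal (p n) (q n).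
  by apply: rideal_comp; have [] := abP (dom (p n)).
have pD m k : rideal (p m) (p (k + m)%N).
  elim: k => [|k IHk]; first exact: rideal_self.
  exact: rideal_sub IHk _ (pS _).
(* For [m < n], [q n] is a multiple of [p m.+1]. After [p m], the paths to [q m] and [q n] branch
   into the disjoint [a] and [b], so cancelling [p m] from a common multiple is contradictory. *)
have lt m n : (m < n)%N -> rideal (q m) `&` rideal (q n) = set0.
  move=> mn; rewrite -subset0 => z [[y /= yq yz] nz].
  have : rideal (p m.+1) z.
    apply: rideal_sub nz; apply: rideal_sub (pq n).
    by rewrite -(subnK mn); exact: pD.
  move=> [y' /= yp' y'z]; have [a_tgt b_tgt ab0] := abP (dom (p m)).
  suff : (rideal (ab (dom (p m))).1 `&` rideal (ab (dom (p m))).2)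
      (comp (ab (dom (p m))).1 y).
    by rewrite ab0.
  split; first by apply: rideal_comp; rewrite yq dom_comp.
  exists y'; first by rewrite /= yp' dom_comp.
  have yq' : dom (ab (dom (p m))).1 = tgt y by rewrite yq dom_comp.
  have yp'' : dom (ab (dom (p m))).2 = tgt y' by rewrite yp' dom_comp.
  apply: (@lc_cancel C (p m)); rewrite ?tgt_comp //.
  by rewrite !compA // [LHS]y'z -yz.
exists q; split=> [n|m n].
  by have /rideal_sub := pD 0 n; rewrite addn0; apply.
by move=> /eqP; rewrite neq_ltn => /orP[/lt|/lt] //; rewrite setIC.
Qed.

(* The bisection of all germs [c v, x] with [x] in [B] and [x (vC) = 1]. *)
Lemma bisection_over (X : set (Jhat C)) (X_inv : invariant X)
    (c : obj C -> mor C) (B : set X) :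
  (forall v, dom (c v) = v) -> compact B -> open B ->
  (forall (x y : X) v w, B x -> B y -> ev (\val x) (J_obj v) ->
    ev (\val y) (J_obj w) -> v <> w -> rideal (c v) `&` rideal (c w) = set0) ->
  exists U : set (arrow (transformation_groupoid X_inv)),
    [/\ compact U, open U, bisection U,
        @src (transformation_groupoid X_inv) @` U = B &
      forall y, (@rng (transformation_groupoid X_inv) @` U) y ->
        exists x v, [/\ B x, ev (\val x) (J_obj v) &
          ev (\val y) (J_dom (Il_inv (Il_lmul (c v))))]].
Proof.
move=> dom_c cB oB disj.
have objE v : J_dom (Il_lmul (c v)) = J_obj v.
  by apply: J_inj; rewrite J_lmulE J_objE dom_c.
(* [t] is a section of the source map on all of [X]; it is well determined since [x (vC) = 1] for
   only one [v]. *)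
have /choice[t tP] : forall x : X, exists g : germ_arrow X, exists v,
    exists h : ev (\val x) (J_dom (Il_lmul (c v))), g = gclass h.
  move=> x; have [v xv] := ev_obj (\val x); rewrite -objE in xv.
  by exists (gclass xv), v, xv.
have tE x v (h : ev (\val x) (J_dom (Il_lmul (c v)))) : t x = gclass h.
  have [w [k ->]] := tP x; have wv : w = v.
    by apply: (@ev_obj_inj C (\val x)); rewrite -objE.
  by subst w; rewrite (bool_irrelevance h k).
have src_t x : germ_src (t x) = x by have [v [h ->]] := tP x; rewrite germ_srcE.
have t_cont : continuous t.
  move=> x N; have [v [h ->]] := tP x => /nbhs_gclass.
  by apply: filterS => y [k Nk]; rewrite /= (tE _ _ k).
exists (t @` B); split.
- exact: continuous_compact (continuous_subspaceT t_cont) cB.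
- have -> : t @` B = \bigcup_v [set g | exists x (h : ev (\val x)
      (J_dom (Il_lmul (c v)))), B x /\ g = gclass h].
    apply/seteqP; split=> [_ [x Bx <-]|g [v _ [x [h [Bx ->]]]]].
      by have [v [h ->]] := tP x; exists v => //; exists x, h.
    by exists x.
  by apply: bigcup_open => v _; exact: open_gclass.
- split=> [_ _ /set_mem[x Bx <-] /set_mem[y By <-]|].
    by move=> /=; rewrite !src_t => ->.
  move=> _ _ /set_mem[x Bx <-] /set_mem[y By <-] /=.
  have [v [h tx]] := tP x; have [w [k ty]] := tP y.
  rewrite tx ty !germ_rngE => /(congr1 val) /= hk.
  (* Equal ranges force equal objects, since the range over [v] takes the value 1 at the ideal of
     [c v]. *)
  have vw : v = w.
    apply: contrapT => vw; have yw := act_dom_inv k.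
    have xv := act_dom_inv h; rewrite -hk in yw.
    have [z] := ev_meet_nonempty xv yw; rewrite !J_lmulVE => zv zw.
    have : (rideal (c v) `&` rideal (c w)) z by [].
    by rewrite (disj x y) -?objE.
  subst w; suff xy : x = y by subst y; rewrite (bool_irrelevance h k).
  apply: val_inj; rewrite /= -(act_invK (act_dom_inv h)).
  rewrite -[RHS](act_invK (act_dom_inv k)).
  move: (act_dom_inv h) (act_dom_inv k); rewrite hk => h' k'.
  by rewrite (bool_irrelevance h' k').
- apply/seteqP; split=> [_ [_ [x Bx <-] <-]|x Bx]; first by rewrite /= src_t.
  by exists (t x); [exists x|exact: src_t].
- move=> _ [_ [x Bx <-] <-]; have [v [h ->]] := tP x.
  exists x, v; split=> //; first by rewrite -objE.
  have -> : @rng (transformation_groupoid X_inv) (gclass h) = actX X_inv h.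
    exact: germ_rngE.
  exact: act_dom_inv.
Qed.

Lemma disjoint_purely_infinite : (forall v w : obj C, homset w v !=set0) ->
  (forall v : obj C, exists a b : mor C,
    [/\ into v a, into v b & rideal a `&` rideal b = set0]) ->
  purely_infinite G.
Proof.
move=> conn dis B cB oB; have [->|/set0P Bne] := eqVneq B set0.
  exists set0, set0; rewrite !image_set0.
  have b0 : @bisection G set0 by split=> g h; rewrite inE.
  rewrite setU0 setI0; split=> //.
  - by split; [exact: compact0|exact: open0|].
  - by split; [exact: compact0|exact: open0|].
have [e [a ea] eB] := open_bdOmega oB Bne.
have [q [aq dq]] := disjoint_sequence a dis.
have /choice[d dP] : forall vw : obj C * obj C, exists d, homset vw.2 vw.1 d.
  by move=> [v w]; exact: conn.
have [vs mem_vs] := compact_finite_objects cB.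
(* Even indices serve [U] ([i = 0]) and odd ones [V] ([i = 1]); [index] in [vs] separates the
   objects that [B] meets. *)
pose r i (v : obj C) := q ((index (v : {classic obj C}) vs).*2 + i)%N.
pose c i v := comp (r i v) (d (v, dom (r i v))).
have dom_c i v : dom (c i v) = v.
  by have [? ?] := dP (v, dom (r i v)); rewrite dom_comp.
have c_r i v : rideal (c i v) `<=` rideal (r i v).
  by apply: rideal_sub; apply: rideal_comp; have [] := dP (v, dom (r i v)).
have disj i (x y : @bdOmega C) v w : B x -> B y -> ev (\val x) (J_obj v) ->
    ev (\val y) (J_obj w) -> v <> w ->
    rideal (c i v) `&` rideal (c i w) = set0.
  move=> Bx By xv yw vw; rewrite -subset0 => z [/c_r zv /c_r zw].
  suff rvw : rideal (r i v) `&` rideal (r i w) = set0.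
    by have : (rideal (r i v) `&` rideal (r i w)) z by []; rewrite rvw.
  apply: dq => /addIn/double_inj/(@index_inj _ (v : {classic obj C})) E.
  apply: vw; apply: E.
  - exact: mem_vs xv.
  - exact: mem_vs yw.
have rng_B i y v : ev (\val y) (J_dom (Il_inv (Il_lmul (c i v)))) -> B y.
  move=> yc; apply: eB; apply: ev_mono yc.
  rewrite J_lmulVE; apply: subset_trans (c_r i v) _.
  by apply: subset_trans (rideal_sub (aq _)) _; exact: J_rideal.
have [U [cU oU bU sU rU]] :=
  bisection_over (@bdOmega_invariant C) (dom_c 0) cB oB (disj 0).
have [V [cV oV bV sV rV]] :=
  bisection_over (@bdOmega_invariant C) (dom_c 1) cB oB (disj 1).
exists U, V; split=> //.
  by move=> y [/rU|/rV] [x [v [_ _]]]; exact: rng_B.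
rewrite -subset0 => y [/rU[_ [v [_ _ yv]]] /rV[_ [w [_ _ yw]]]].
have [z] := ev_meet_nonempty yv yw; rewrite !J_lmulVE => /c_r zv /c_r zw.
suff rvw : rideal (r 0 v) `&` rideal (r 1 w) = set0.
  by have : (rideal (r 0 v) `&` rideal (r 1 w)) z by []; rewrite rvw.
(* Parity separates the two families even when [v = w]. *)
by apply: dq => /(congr1 odd); rewrite addn0 addn1 /= !odd_double.
Qed.

End PurelyInfinite.

Theorem proposition5p21 (C : lcCategory) (C_nonempty : inhabited (obj C)) :
  let Pa := smallest_nonempty_closed_invariant [set: Jhat C] (@bdOmega C) in
  let Pb := smallest_nonempty_closed_invariant (@Omega C) (@bdOmega C) in
  let Pc := forall v w : obj C, homset w v !=set0 in
  [/\ Pa <-> Pb, Pb <-> Pc &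
      Pc -> (purely_infinite (transformation_groupoid (@bdOmega_invariant C)) <->
            forall v : obj C, exists a b : mor C,
              [/\ into v a, into v b & rideal a `&` rideal b = set0])].
Proof.
have ca := connected_smallest C_nonempty.
split=> [||conn]; split.
- exact: smallest_Omega.
- by move=> /smallest_connected/ca.
- exact: smallest_connected.
- by move=> /ca/smallest_Omega.
- exact: purely_infinite_disjoint.
- exact: disjoint_purely_infinite.
Qed.
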